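(* Let $i\ge j\ge 1$, $k\ge 1$, $l\ge 1$ be integers with $i+j+k+l=n-3$. Then $F(R_{i+1,j-1,k,l}) > F(R_{i,j,k,l})$. In particular, $F(R_{i+j,0,k,l}) > F(R_{i,j,k,l})$.
   Context: All graphs are finite and simple. The F-index of a graph $G$ is $F(G)=\sum_{v\in V(G)} d_G(v)^3$. For integers $i,j\ge 0$ and $k,l\ge 1$, $R_{i,j,k,l}$ is the graph obtained from a triangle $xyz$ by attaching $i$ new leaves to $x$, $j$ new leaves to $y$ and $k$ new pendant vertices to $z$, and then attaching $l$ new leaves to one of the $k$ pendant vertices adjacent to $z$ (here attaching a leaf to a vertex means adding a new vertex adjacent only to it). It has $i+j+k+l+3$ vertices. *)

(* Defs.v *)
From mathcomp Require Import all_boot.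
From mathcomp Require Import zify.

Set Implicit Arguments.
Unset Strict Implicit.
Unset Printing Implicit Defensive.

Record sgraph := SGraph {
  vertex :> finType;
  adj : rel vertex;
  adj_sym : symmetric adj;
  adj_irrefl : irreflexive adj
}.

Definition deg (G : sgraph) (v : G) : nat := #|[set u : G | adj v u]|.

Definition Findex (G : sgraph) : nat := \sum_(v : G) deg v ^ 3.

Section AttachLeaves.
Variables (G : sgraph) (v : G) (m : nat).

(* The old vertices are the [inl u], the m new leaves are the [inr p]. *)
Definition attach_adj : rel (G + 'I_m) := fun a b =>
  match a, b with
  | inl u, inl w => adj u w
  | inl u, inr _ => u == v
  | inr _, inl w => w == v
  | inr _, inr _ => false
  end.

Lemma attach_adj_sym : symmetric attach_adj.
Proof. by move=> [u|p] [w|q] //=; apply: adj_sym. Qed.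

Lemma attach_adj_irrefl : irreflexive attach_adj.
Proof. by move=> [u|p] //=; apply: adj_irrefl. Qed.

Definition attach_leaves : sgraph := SGraph attach_adj_sym attach_adj_irrefl.

End AttachLeaves.

Definition triangle_adj : rel 'I_3 := fun u w => u != w.

Lemma triangle_adj_sym : symmetric triangle_adj.
Proof. by move=> u w; rewrite /triangle_adj eq_sym. Qed.

Lemma triangle_adj_irrefl : irreflexive triangle_adj.
Proof. by move=> u; rewrite /triangle_adj eqxx. Qed.

Definition triangle : sgraph := SGraph triangle_adj_sym triangle_adj_irrefl.

Definition tri_x : triangle := @Ordinal 3 0 isT.
Definition tri_y : triangle := @Ordinal 3 1 isT.
Definition tri_z : triangle := @Ordinal 3 2 isT.

(* The l leaves go to the pendant neighbour of z with index 0 among the k new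
   ones; [hk] is what makes this index available. *)
Definition Rgraph (i j k l : nat) (hk : 0 < k) : sgraph :=
  let G1 := attach_leaves tri_x i in
  let G2 := attach_leaves (inl tri_y : G1) j in
  let G3 := attach_leaves (inl (inl tri_z) : G2) k in
  attach_leaves (inr (Ordinal hk) : G3) l.

Arguments Rgraph : clear implicits.

Lemma card_Rgraph (i j k l : nat) (hk : 0 < k) :
  #|Rgraph i j k l hk| = i + j + k + l + 3.
Proof. by rewrite !card_sum !card_ord; lia. Qed.

(* Main.v *)
(* Attaching m leaves to v only raises the degree of v by m and adds m vertices
   of degree 1; iterating this gives
   F(R_{i,j,k,l}) = (i+2)^3 + (j+2)^3 + (k+2)^3 + (l+1)^3 + i + j + k + l - 1,
   and the theorem follows from the convexity of the cube. *)
Require Import Defs.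
From mathcomp Require Import all_boot.
From mathcomp Require Import zify ring.

Lemma deg_sum (G : sgraph) (v : G) : deg v = \sum_(u : G) adj v u.
Proof. by rewrite /deg cardsE -sum1_card big_mkcond. Qed.

Lemma deg_attach_old (G : sgraph) (v : G) (m : nat) (u : G) :
  deg (inl u : attach_leaves v m) = deg u + (u == v) * m.
Proof.
by rewrite !deg_sum big_sumType /= sum_nat_const card_ord mulnC.
Qed.

Lemma deg_attach_leaf (G : sgraph) (v : G) (m : nat) (p : 'I_m) :
  deg (inr p : attach_leaves v m) = 1.
Proof.
rewrite deg_sum big_sumType /= big1_eq addn0 (bigD1 v) //= eqxx.
by rewrite big1 // => w /negbTE ->.
Qed.

(** Only the term of [v] changes, and each new leaf contributes 1. The old cube stands on the left
    to avoid truncated subtraction. *)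
Lemma Findex_attach (G : sgraph) (v : G) (m : nat) :
  Findex (attach_leaves v m) + deg v ^ 3 = Findex G + (deg v + m) ^ 3 + m.
Proof.
rewrite /Findex big_sumType /= (bigD1 v) //= [in RHS](bigD1 v) //=.
rewrite deg_attach_old eqxx mul1n.
under eq_bigr => u /negbTE uv do rewrite deg_attach_old uv addn0.
under [X in _ + X + _ = _]eq_bigr => p _ do rewrite deg_attach_leaf exp1n.
rewrite sum_nat_const card_ord muln1.
lia.
Qed.

Lemma deg_triangle (v : triangle) : deg v = 2.
Proof. by rewrite deg_sum !big_ord_recl big_ord0; case: v => [[|[|[|]]]]. Qed.

Lemma Findex_triangle : Findex triangle = 24.
Proof.
rewrite /Findex (eq_bigr (fun=> 8)) => [|v _]; last by rewrite deg_triangle.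
by rewrite sum_nat_const card_ord.
Qed.

(** The four attachments telescope: the three replaced cubes [2 ^ 3] cancel the 24 of the triangle,
    and the replaced [1 ^ 3] leaves the [+ 1] on the left. *)
Lemma Findex_Rgraph (i j k l : nat) (hk : 0 < k) :
  Findex (Rgraph i j k l hk) + 1 =
  (i + 2) ^ 3 + (j + 2) ^ 3 + (k + 2) ^ 3 + (l + 1) ^ 3 + (i + j + k + l).
Proof.
rewrite /Rgraph.
set G1 := attach_leaves tri_x i.
set G2 := attach_leaves (inl tri_y : G1) j.
set G3 := attach_leaves (inl (inl tri_z) : G2) k.
have F1 := @Findex_attach triangle tri_x i.
have F2 := @Findex_attach G1 (inl tri_y) j.
have F3 := @Findex_attach G2 (inl (inl tri_z)) k.
have F4 := @Findex_attach G3 (inr (Ordinal hk)) l.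
rewrite deg_triangle Findex_triangle in F1.
(* The corners are distinct, so [y] still has degree 2 after the leaves at [x] are attached. *)
rewrite deg_attach_old deg_triangle /= addn0 in F2.
rewrite !deg_attach_old deg_triangle /= !addn0 in F3.
rewrite deg_attach_leaf in F4.
move: F1 F2 F3 F4; rewrite -/G1 -/G2 -/G3 => F1 F2 F3 F4.
rewrite !(addnC _ 2) (addnC l 1).
move: (Findex G1) (Findex G2) (Findex G3) (Findex (attach_leaves _ _)) F1 F2 F3 F4.
move: ((2 + i) ^ 3) ((2 + j) ^ 3) ((2 + k) ^ 3) ((1 + l) ^ 3) => *.
lia.
Qed.

(** The increment [(x + d) ^ 3 - x ^ 3 = 3 * d * x * (x + d) + d ^ 3] is strictly increasing in [x]
    when [d > 0]. *)
Lemma ltn_cubeD (a b d : nat) :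
  b < a -> 0 < d -> a ^ 3 + (b + d) ^ 3 < (a + d) ^ 3 + b ^ 3.
Proof.
move=> ba d_gt0.
have cubeD x : (x + d) ^ 3 = x ^ 3 + 3 * (d * (x * (x + d))) + d ^ 3.
  by rewrite !expnS !expn0; ring.
have lt_mul : d * (b * (b + d)) < d * (a * (a + d)).
  by rewrite ltn_pmul2l // ltn_mul // ltn_add2r.
rewrite !cubeD.
move: (a ^ 3) (b ^ 3) (d ^ 3) (d * _) (d * _) lt_mul => *.
lia.
Qed.

Theorem theorem6 (n i j k l : nat) (hij : j <= i) (hj : 1 <= j)
    (hk : 1 <= k) (hl : 1 <= l) (hn : i + j + k + l = n - 3) :
  Findex (Rgraph (i + 1) (j - 1) k l hk) > Findex (Rgraph i j k l hk) /\
  Findex (Rgraph (i + j) 0 k l hk) > Findex (Rgraph i j k l hk).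
Proof.
have F0 := Findex_Rgraph i j k l hk.
have F1 := Findex_Rgraph (i + 1) (j - 1) k l hk.
have F2 := Findex_Rgraph (i + j) 0 k l hk.
case: j hij hj hn F0 F1 F2 => // j hij _ _ F0.
rewrite subn1 /= => F1 F2.
(* Here [j] is the predecessor of the original one, so [j + 2] is the degree of [y] after losing one
   leaf. *)
have step := @ltn_cubeD (i + 2) (j + 2) 1 ltac:(lia) ltac:(lia).
(* All [j.+1] leaves move at once, leaving [y] with degree 2; no induction on single moves is
   made. *)
have jump := @ltn_cubeD (i + 2) 2 j.+1 ltac:(lia) ltac:(lia).
(* Equal cubes must agree syntactically before they are generalized to make the goal linear. *)
rewrite (_ : i + 1 + 2 = i + 2 + 1) in F1; last lia.
rewrite (_ : j.+1 + 2 = j + 2 + 1) in F0; last lia.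
rewrite (_ : 2 + j.+1 = j + 2 + 1) in jump; last lia.
rewrite (_ : i + j.+1 + 2 = i + 2 + j.+1) in F2; last lia.
rewrite add0n in F2.
move: ((i + 2) ^ 3) ((j + 2) ^ 3) ((j + 2 + 1) ^ 3) ((i + 2 + 1) ^ 3)
  ((i + 2 + j.+1) ^ 3) ((k + 2) ^ 3) ((l + 1) ^ 3) (2 ^ 3)
  step jump F0 F1 F2 => *.
by split; lia.
Qed.
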